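(* Let $p>1$. There exists a random variable $Z\in\mathbb{D}^{1,p}$ such that $Z$ does not satisfy $(\mathrm{SSGD}_p(p))$. That is, there exists $Z\in\mathbb{D}^{1,p}$ for which there is no $\mathcal{D}Z\in L^p(H)$ such that, for every $h\in H$, $$\lim_{\varepsilon\to 0}\mathbb{E}\left[\left|\frac{Z\circ\tau_{\varepsilon h}-Z}{\varepsilon}-\langle \mathcal{D}Z,h\rangle_H\right|^p\right]=0.$$
   Context: Fix the time horizon $T=1$. Let $\Omega:=C_0([0,T],\mathbb{R})$ be the space of continuous functions $\omega:[0,T]\to\mathbb{R}$ with $\omega(0)=0$, let $\mathcal{F}$ be its Borel $\sigma$-algebra for the uniform topology, let $W_t(\omega):=\omega(t)$ be the coordinate process, and let $\mathbb{P}_0$ be the Wiener measure, under which $W$ is a standard Brownian motion. $\mathcal{F}_T$ denotes the $\mathbb{P}_0$-completion of $\mathcal{F}$, and $\mathbb{E}$ is expectation under $\mathbb{P}_0$. Random variables are $\mathcal{F}_T$-measurable and identified when they are $\mathbb{P}_0$-a.s. equal. The Cameron-Martin space is $$H:=\left\{h:[0,T]\to\mathbb{R} :\ \exists\,\dot h \text{ Borel with } \int_0^T|\dot h(s)|^2ds<+\infty \text{ and } h(t)=\int_0^t\dot h(x)\,dx \ \ \forall t\in[0,T]\right\},$$ a Hilbert space with inner product $\langle h_1,h_2\rangle_H:=\int_0^T\dot h_1(t)\dot h_2(t)\,dt$ and norm $\|h\|_H$. For a Hilbert space $\mathcal{K}$ and $p\ge 1$, $L^p(\mathcal{K})$ is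 the set of $\mathcal{F}_T$-measurable $\mathcal{K}$-valued random variables $Z$ with $\mathbb{E}[\|Z\|_{\mathcal{K}}^p]<+\infty$. For $h\in H$, the shift $\tau_h:\Omega\to\Omega$ is $\tau_h(\omega):=\omega+h$. (By the Cameron-Martin theorem $Z\circ\tau_h$ is well defined up to $\mathbb{P}_0$-a.s. equality.) Let $\mathcal{S}$ be the set of random variables of the form $Z=f(W(h_1),\dots,W(h_n))$ with $n\ge 1$, $h_1,\dots,h_n\in H$, $f$ a real polynomial in $n$ variables, where $W(h):=\int_0^T\dot h_s\,dW_s$. For such $Z$ the Malliavin derivative is the $H$-valued random variable $\nabla Z:=\sum_{i=1}^n \frac{\partial f}{\partial x_i}(W(h_1),\dots,W(h_n))\,h_i$. For $p>1$, $\mathbb{D}^{1,p}$ is the closure of $\mathcal{S}$ with respect to $\|Z\|_{1,p}:=\left(\mathbb{E}[|Z|^p]+\mathbb{E}[\|\nabla Z\|_H^p]\right)^{1/p}$, i.e. the set of $Z\in L^p(\mathbb{R})$ for which there is a sequence $(Z_n)$ in $\mathcal{S}$ converging to $Z$ in $L^p(\mathbb{R})$ with $(\nabla Z_n)$ Cauchy in $L^p(H)$. A random variable $Z\in L^p(\mathbb{R})$ is said to satisfy $(\mathrm{SSGD}_p(p))$ if there exists $\mathcal{D}Z\in L^p(H)$ such that for every $h\in H$ $$\lim_{\varepsilon\to 0}\mathbb{E}\left[\left|\frac{Z\circ\tau_{\varepsilon h}-Z}{\varepsilon}-\langle \mathcal{D}Z,h\rangle_H\right|^p\right]=0.$$ 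*)

(* Defs.v *)
From HB Require Import structures.
From mathcomp Require Import all_boot all_order all_algebra.
From mathcomp Require Import all_classical all_reals all_analysis.
From mathcomp Require Import measurable_realfun.
From mathcomp Require mpoly.
From mathcomp Require Import ring lra.

Set Implicit Arguments.
Unset Strict Implicit.
Unset Printing Implicit Defensive.

Import Order.TTheory GRing.Theory Num.Theory.
Import numFieldNormedType.Exports.

Local Open Scope classical_set_scope.
Local Open Scope ring_scope.

(* The time interval [0, T] with T = 1, as a set and as a type. *)
Definition unit_itv (R : realType) : set R := `[0, 1]%classic.
Arguments unit_itv R : clear implicits.
Definition time (R : realType) : Type := set_type (unit_itv R).

Section cameron_martin_space.
Context {R : realType}.
Local Notation mu := (@lebesgue_measure R).
Local Notation I := (unit_itv R).

Lemma time0_subproof : (0 : R) \in I.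
Proof. by rewrite mem_setE in_itv/= lexx ler01. Qed.
Definition time0 : time R := exist _ 0 time0_subproof.

(* [g] is a square-integrable density of [h]; it is unique a.e. on [0, 1]
   by [cm_density_uniq]. *)
Definition cm_density (h : time R -> R) (g : R -> R) : Prop :=
  [/\ measurable_fun I g,
      (\int[mu]_(x in I) (g x ^+ 2)%:E < +oo)%E &
      forall t : time R, h t = \int[mu]_(x in `[0, val t]) g x].

Let mI : measurable I. Proof. exact: measurable_itv. Qed.

Let muI : (mu I < +oo)%E.
Proof. by rewrite lebesgue_measure_itv/= lte_fin ltr01 sube0 ltry. Qed.

Lemma sq_integrableP (g : R -> R) : measurable_fun I g ->
  (\int[mu]_(x in I) (g x ^+ 2)%:E < +oo)%E <->
  mu.-integrable I (fun x => (g x ^+ 2)%:E).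
Proof.
move=> mg; split=> [fin|/integrableP[_]].
  apply/integrableP; split.
    by apply/measurable_EFinP; exact: measurable_funX.
  by under eq_integral do rewrite gee0_abs ?lee_fin ?sqr_ge0//.
by under eq_integral do rewrite gee0_abs ?lee_fin ?sqr_ge0//.
Qed.

Lemma sq_integrableM (g1 g2 : R -> R) :
  measurable_fun I g1 -> measurable_fun I g2 ->
  mu.-integrable I (fun x => (g1 x ^+ 2)%:E) ->
  mu.-integrable I (fun x => (g2 x ^+ 2)%:E) ->
  mu.-integrable I (fun x => (g1 x * g2 x)%:E).
Proof.
move=> m1 m2 i1 i2.
apply: (@le_integrable _ _ _ mu I mI _
  (fun x => ((g1 x ^+ 2)%:E + (g2 x ^+ 2)%:E)%E)).
- by apply/measurable_EFinP; exact: measurable_funM.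
- move=> x _; rewrite -EFinD !abse_EFin lee_fin.
  rewrite (@ger0_norm _ (_ + _)) ?addr_ge0 ?sqr_ge0// normrM.
  rewrite -[g1 x ^+ 2]real_normK ?num_real// -[g2 x ^+ 2]real_normK ?num_real//.
  have := sqr_ge0 (`|g1 x| - `|g2 x|).
  have := mulr_ge0 (normr_ge0 (g1 x)) (normr_ge0 (g2 x)).
  nra.
- exact: integrableD.
Qed.

Lemma sq_integrable1 (g : R -> R) : measurable_fun I g ->
  mu.-integrable I (fun x => (g x ^+ 2)%:E) -> mu.-integrable I (EFin \o g).
Proof.
move=> mg ig.
have -> : EFin \o g = (fun x => (g x * cst 1 x)%:E).
  by apply/funext => x /=; rewrite mulr1.
apply: sq_integrableM => //.
have -> : (fun x : R => (cst 1 x ^+ 2)%:E) = EFin \o cst (1 : R).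
  by apply/funext => x /=; rewrite expr1n.
by apply: measurable_bounded_integrable => //; exact: bounded_cst.
Qed.

Lemma sq_integrable_lin (a : R) (g1 g2 : R -> R) :
  measurable_fun I g1 -> measurable_fun I g2 ->
  mu.-integrable I (fun x => (g1 x ^+ 2)%:E) ->
  mu.-integrable I (fun x => (g2 x ^+ 2)%:E) ->
  mu.-integrable I (fun x => ((a * g1 x + g2 x) ^+ 2)%:E).
Proof.
move=> m1 m2 i1 i2.
rewrite [X in integrable _ _ X](_ : _ = (fun x =>
   ((a ^+ 2)%:E * (g1 x ^+ 2)%:E +
   ((2 * a)%:E * (g1 x * g2 x)%:E + (g2 x ^+ 2)%:E))%E)); last first.
  by apply/funext => x; rewrite -!EFinM -!EFinD; congr EFin; ring.
apply: integrableD => //; first exact: integrableZl.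
apply: integrableD => //; apply: integrableZl => //.
exact: sq_integrableM.
Qed.

Let subI (t : time R) : `[0, val t]%classic `<=` I.
Proof.
move=> x /=; rewrite /unit_itv/= !in_itv/= => /andP[-> xt] /=.
case: t xt => t /= + xt; rewrite inE /unit_itv/= in_itv/= => /andP[_].
exact: le_trans.
Qed.

Let intS (g : R -> R) (t : time R) : mu.-integrable I (EFin \o g) ->
  mu.-integrable `[0, val t] (EFin \o g).
Proof. by apply: integrableS => //; exact: subI. Qed.

Lemma cm_density_lin a h1 h2 g1 g2 : cm_density h1 g1 -> cm_density h2 g2 ->
  cm_density (a *: h1 + h2) (fun x => a * g1 x + g2 x).
Proof.
move=> [m1 /(sq_integrableP m1) i1 e1] [m2 /(sq_integrableP m2) i2 e2].
have m : measurable_fun I (fun x => a * g1 x + g2 x).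
  by apply: measurable_funD => //; exact: measurable_funM.
split=> //; first by apply/sq_integrableP => //; exact: sq_integrable_lin.
move=> t; have I1 := intS t (sq_integrable1 m1 i1).
have I2 := intS t (sq_integrable1 m2 i2).
rewrite RintegralD//=; last first.
  rewrite [X in integrable _ _ X](_ : _ =
    (fun x => (a%:E * (EFin \o g1) x)%E)) //.
  exact: integrableZl.
by rewrite RintegralZl// -e1 -e2.
Qed.

Lemma cm_density_uniq h g1 g2 : cm_density h g1 -> cm_density h g2 ->
  g1 = g2 %[ae mu in I].
Proof.
move=> [m1 /(sq_integrableP m1) i1 e1] [m2 /(sq_integrableP m2) i2 e2].
pose g x := g1 x - g2 x.
have ig1 := sq_integrable1 m1 i1; have ig2 := sq_integrable1 m2 i2.
have ig : mu.-integrable I (EFin \o g).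
  have -> : EFin \o g = ((EFin \o g1) \- (EFin \o g2))%E by [].
  exact: integrableB.
have g0 x : I x -> \int[mu]_(u in `[0, x]) g u = 0.
  move=> Ix; pose t : time R := exist _ x (mem_set Ix).
  rewrite (@RintegralB _ _ _ mu `[0, val t]) //; try exact: intS.
  by rewrite -e1 -e2 subrr.
have igT : mu.-integrable setT (EFin \o (g \_ I)).
  have := @integrable_mkcond _ _ R mu I (EFin \o g) mI.
  by rewrite restrict_EFin => -[/(_ ig)].
have ipt y : mu.-integrable [set` Interval (BLeft 0) (BRight y)]
    (EFin \o (g \_ I)).
  exact: integrableS igT.
have := FTC1 ipt (integrable_locally mI ig).
set F := fun x => _ => H1.
have H2 : {ae mu, forall x, x != 0 /\ x != 1}.
  have N a : mu.-negligible [set a : R].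
    exists [set a]; split; [|exact: lebesgue_measure_set1|by []].
    exact: measurable_set1.
  apply: (negligibleS _ (negligibleU (N 0) (N 1))) => x /=.
  move=> /not_andP[/negP|/negP]; rewrite negbK => /eqP ->; [by left|by right].
apply: (filterS2 (ae_filter_ringOfSetsType mu) _ H1 H2) => x Fx [x0 x1] Ix.
have /andP[lx0 lx1] : 0 < x < 1.
  move: Ix; rewrite /unit_itv/= in_itv/= => /andP[? ?].
  by rewrite !lt_neqAle eq_sym x0 x1 /=; apply/andP.
have [|_] := Fx; first by rewrite lte_fin.
have F0 y : I y -> F y = 0.
  move=> Iy; rewrite /F -[RHS](g0 y Iy).
  apply: eq_Rintegral => z; rewrite inE/= => zy.
  rewrite patchE mem_set//; move: Iy zy; rewrite /unit_itv/= !in_itv/=.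
  by move=> /andP[_ y1] /andP[-> /le_trans]; exact.
have -> : F^`()%classic x = 0.
  rewrite derive1E (@near_eq_derive _ _ _ _ (cst 0))//; first exact: derive_cst.
  have : x \in `]0, 1[ by rewrite in_itv/= lx0.
  move/near_in_itvoo; apply: filterS => y; rewrite in_itv/= => /andP[y0 y1].
  by rewrite F0//= /unit_itv/= in_itv/= !ltW.
by rewrite patchE mem_set//; move=> /esym/eqP; rewrite subr_eq0 => /eqP.
Qed.

Definition cm_fun : {pred time R -> R} := mem [set h | exists g, cm_density h g].

Lemma cm_fun_submod_closed : submod_closed cm_fun.
Proof.
split=> [|a h1 h2]; rewrite /cm_fun !inE.
  exists (cst 0); split; first exact: measurable_cst.
    under eq_integral do rewrite expr0n/=.
    by rewrite integral0 ltry.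
  by move=> t; rewrite /Rintegral integral0.
move=> -[g1 d1] [g2 d2]; exists (fun x => a * g1 x + g2 x).
exact: cm_density_lin.
Qed.

HB.instance Definition _ :=
  GRing.isSubmodClosed.Build R (time R -> R) cm_fun cm_fun_submod_closed.

(* The Cameron-Martin space H. *)
Record CM := MkCM { cm_val :> time R -> R; _ : cm_val \in cm_fun }.

HB.instance Definition _ := [isSub for cm_val].
HB.instance Definition _ := [Choice of CM by <:].
HB.instance Definition _ := [SubChoice_isSubLmodule of CM by <:].


Lemma cm_valP (h : CM) : exists g, cm_density h g.
Proof. by case: h => h /=; rewrite /cm_fun inE. Qed.

Definition cm_deriv (h : CM) : R -> R := sval (cid (cm_valP h)).

Lemma cm_derivP (h : CM) : cm_density h (cm_deriv h).
Proof. exact: svalP. Qed.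

(* Independent of the chosen densities by [cm_innerE]. *)
Definition cm_inner (h1 h2 : CM) : R :=
  \int[mu]_(x in I) (cm_deriv h1 x * cm_deriv h2 x).

Definition cm_norm (h : CM) : R := Num.sqrt (cm_inner h h).

Lemma cm_innerE (h1 h2 : CM) g1 g2 : cm_density h1 g1 -> cm_density h2 g2 ->
  cm_inner h1 h2 = \int[mu]_(x in I) (g1 x * g2 x).
Proof.
move=> d1 d2.
have e1 := cm_density_uniq (cm_derivP h1) d1.
have e2 := cm_density_uniq (cm_derivP h2) d2.
have [m1 _ _] := d1; have [m2 _ _] := d2.
have [m1' _ _] := cm_derivP h1; have [m2' _ _] := cm_derivP h2.
congr fine; apply: (ae_eq_integral _ _ _ _) => //.
- by apply/measurable_EFinP; exact: measurable_funM.
- by apply/measurable_EFinP; exact: measurable_funM.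
apply: (filterS2 (ae_filter_ringOfSetsType mu) _ e1 e2) => x x1 x2 Ix.
by rewrite x1// x2.
Qed.

Let integrable_cm_mul (h1 h2 : CM) :
  mu.-integrable I (EFin \o (fun x => cm_deriv h1 x * cm_deriv h2 x)).
Proof.
have [m1 /(sq_integrableP m1) i1 _] := cm_derivP h1.
have [m2 /(sq_integrableP m2) i2 _] := cm_derivP h2.
exact: sq_integrableM.
Qed.

Lemma cm_innerC (h1 h2 : CM) : cm_inner h1 h2 = cm_inner h2 h1.
Proof. by apply: eq_Rintegral => x _; rewrite mulrC. Qed.

Lemma cm_inner_linl a (h1 h2 h : CM) :
  cm_inner (a *: h1 + h2) h = a * cm_inner h1 h + cm_inner h2 h.
Proof.
have d : cm_density (a *: h1 + h2 : CM)
    (fun x => a * cm_deriv h1 x + cm_deriv h2 x).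
  exact: (cm_density_lin a (cm_derivP h1) (cm_derivP h2)).
rewrite (cm_innerE d (cm_derivP h)).
rewrite -RintegralZl// -RintegralD//.
  by apply: eq_Rintegral => x _; rewrite mulrDl mulrA.
pose g x := cm_deriv h1 x * cm_deriv h x.
rewrite [X in integrable _ _ X](_ : _ = (fun x => (a%:E * (EFin \o g) x)%E))//.
by apply: integrableZl => //; exact: integrable_cm_mul.
Qed.

Lemma cm_inner_ge0 (h : CM) : 0 <= cm_inner h h.
Proof. by apply: Rintegral_ge0 => x _; rewrite -expr2 sqr_ge0. Qed.

Lemma cm_inner_eq0 (h : CM) : cm_inner h h = 0 -> h = 0.
Proof.
have [m _ e] := cm_derivP h; move=> ih0.
have : (\int[mu]_(x in I) `|(cm_deriv h x * cm_deriv h x)%:E| = 0)%E.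
  under eq_integral do rewrite gee0_abs ?lee_fin -?expr2 ?sqr_ge0//.
  have := @integrable_fin_num _ _ _ mu I mI _ (integrable_cm_mul h h).
  by move=> /fineK <-; congr EFin.
move/(@ae_eq_integral_abs _ _ _ mu I mI).
have mhh : measurable_fun I (fun x => (cm_deriv h x * cm_deriv h x)%:E).
  by apply/measurable_EFinP; exact: measurable_funM.
move=> /(_ mhh) g0; apply/val_inj/funext => t.
suff : h t = 0 by []; rewrite e.
rewrite /Rintegral (ae_eq_integral (cst 0%E))//.
- by rewrite integral0.
- by apply/measurable_EFinP; apply: measurable_funS m => //; exact: subI.
- apply: (filterS (F := almost_everywhere mu) _ g0) => x /= gx /subI/gx[].
  by move=> /eqP; rewrite mulf_eq0 orbb => /eqP ->.
Qed.

Lemma cm_innerZl a (h1 h2 : CM) : cm_inner (a *: h1) h2 = a * cm_inner h1 h2.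
Proof.
have z : cm_inner 0 h2 = 0.
  have := cm_inner_linl (-1) 0 0 h2.
  by rewrite scaler0 addr0 mulN1r addNr.
by rewrite -[a *: h1]addr0 cm_inner_linl z addr0.
Qed.

Lemma cm_innerDl (h1 h2 h : CM) :
  cm_inner (h1 + h2) h = cm_inner h1 h + cm_inner h2 h.
Proof. by rewrite -[h1 in LHS]scale1r cm_inner_linl mul1r. Qed.

Lemma cm_CauchySchwarz (x y : CM) : `|cm_inner x y| <= cm_norm x * cm_norm y.
Proof.
rewrite -sqrtrM ?cm_inner_ge0// -sqrtr_sqr ler_wsqrtr//.
have [y0|y0] := eqVneq (cm_inner y y) 0.
  have := cm_innerZl 0 0 x; rewrite scale0r mul0r => z.
  by rewrite y0 mulr0 (cm_inner_eq0 y0) cm_innerC z expr0n.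
have yp : 0 < cm_inner y y by rewrite lt_def y0 cm_inner_ge0.
have := cm_inner_ge0 (cm_inner y y *: x + (- cm_inner x y) *: y).
rewrite cm_innerDl !cm_innerZl ![cm_inner _ (_ + _)]cm_innerC.
rewrite !cm_innerDl !cm_innerZl (cm_innerC y x) => q.
rewrite -(ler_pM2l yp); nra.
Qed.

Lemma cm_normD (x y : CM) : cm_norm (x + y) <= cm_norm x + cm_norm y.
Proof.
have n0 z : 0 <= cm_norm z by exact: sqrtr_ge0.
rewrite -(@ler_pXn2r _ 2)// ?nnegrE ?addr_ge0//.
rewrite sqrrD !sqr_sqrtr ?cm_inner_ge0//.
rewrite cm_innerDl ![cm_inner _ (_ + _)]cm_innerC !cm_innerDl (cm_innerC y x).
have := le_trans (ler_norm _) (cm_CauchySchwarz x y).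
by rewrite /cm_norm; lra.
Qed.

Lemma cm_normZ a (x : CM) : cm_norm (a *: x) = `|a| * cm_norm x.
Proof.
rewrite /cm_norm cm_innerZl cm_innerC cm_innerZl mulrA -expr2.
by rewrite sqrtrM ?sqr_ge0// sqrtr_sqr.
Qed.

Lemma cm_norm_eq0 (x : CM) : cm_norm x = 0 -> x = 0.
Proof.
move/eqP; rewrite sqrtr_eq0 => x0; apply: cm_inner_eq0.
by apply/eqP; rewrite eq_le x0 cm_inner_ge0.
Qed.

HB.instance Definition _ :=
  Lmodule_isNormed.Build R CM cm_normD cm_normZ cm_norm_eq0.

(* H carries the Borel sigma-algebra of its norm. *)
HB.instance Definition _ := Measurable.copy CM (g_sigma_algebraType (@open CM)).

Lemma cm_continuous (h : CM) : continuous h.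
Proof.
have [m /(sq_integrableP m) i e] := cm_derivP h.
have -> : (h : time R -> R) =
    sigL I (fun x => parameterized_integral mu 0 x (cm_deriv h)).
  by apply/funext => t; rewrite e.
apply/subspace_sigL_continuousP.
exact: parameterized_integral_continuous ler01 (sq_integrable1 m i).
Qed.

Lemma cm_time0 (h : CM) : h time0 = 0.
Proof.
have [_ _ ->] := cm_derivP h.
by rewrite /= set_itv1 Rintegral_set1.
Qed.

End cameron_martin_space.
Arguments CM R : clear implicits.

Section path_space.
Context {R : realType}.

Definition path_fun : {pred time R -> R} :=
  mem [set w : time R -> R | continuous w /\ w time0 = 0].

(* The Wiener space Omega, with the uniform topology and its Borel
   sigma-algebra (instances below). *)
Record C0 := MkC0 { C0_val :> time R -> R; _ : C0_val \in path_fun }.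

HB.instance Definition _ := [isSub for C0_val].
HB.instance Definition _ := [Choice of C0 by <:].

Lemma C0_continuous (w : C0) : continuous w.
Proof. by case: w => w /=; rewrite /path_fun inE => -[]. Qed.

Lemma C0_time0 (w : C0) : w time0 = 0.
Proof. by case: w => w /=; rewrite /path_fun inE => -[]. Qed.

Lemma tau_subproof (h : CM R) (w : C0) : (w : time R -> R) \+ h \in path_fun.
Proof.
rewrite /path_fun inE/=; split; last by rewrite C0_time0 cm_time0 addr0.
by move=> t; apply: continuousD; [exact: C0_continuous|exact: cm_continuous].
Qed.

Definition tau (h : CM R) (w : C0) : C0 := MkC0 (tau_subproof h w).

Lemma path0_subproof : cst 0 \in path_fun.
Proof. by rewrite /path_fun inE/=; split=> // t; exact: cst_continuous. Qed.

HB.instance Definition _ := isPointed.Build C0 (MkC0 path0_subproof).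

Definition path_uniform (w : C0) : {uniform time R -> R} := C0_val w.
HB.instance Definition _ := Uniform.copy C0 (initial_topology path_uniform).
HB.instance Definition _ := Measurable.copy C0 (g_sigma_algebraType (@open C0)).

End path_space.
Arguments C0 R : clear implicits.

Section outer_measure_completion.
Context d (T : measurableType d) (R : realType) (P : probability T R).
Local Open Scope ereal_scope.

Lemma outer_measurable_hull (E : set T) :
  exists B, [/\ measurable B, E `<=` B & P B = (P^*)%mu E].
Proof.
have fE : (P^*)%mu E \is a fin_num.
  rewrite ge0_fin_numE ?outer_measure_ge0//.
  apply: (@le_lt_trans _ _ ((P^*)%mu setT)); first exact: le_outer_measure.
  have -> : (P^*)%mu setT = P setT by exact: measurable_mu_extE.
  by rewrite probability_setT ltry.
have cov n : exists B, [/\ measurable B, E `<=` B &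
    P B <= (P^*)%mu E + n.+1%:R^-1%:E].
  have n0 : (0 < n.+1%:R^-1 :> R)%R by rewrite invr_gt0.
  have [_ [A [mA EA] <-] PA] := lb_ereal_inf_adherent n0 fE.
  exists (\bigcup_k A k); split => //; first exact: bigcupT_measurable.
  apply: le_trans (ltW PA).
  by apply: measure_sigma_subadditive => //; exact: bigcupT_measurable.
pose B n := sval (cid (cov n)).
have BP n : [/\ measurable (B n), E `<=` B n &
    P (B n) <= (P^*)%mu E + n.+1%:R^-1%:E] := svalP (cid (cov n)).
have mB : measurable (\bigcap_n B n).
  by apply: bigcapT_measurable => n; have [] := BP n.
have EB : E `<=` \bigcap_n B n by move=> x Ex n _; have [_ + _] := BP n; exact.
exists (\bigcap_n B n); split => //.
apply/eqP; rewrite eq_le; apply/andP; split; last first.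
  have <- : (P^*)%mu (\bigcap_n B n) = P (\bigcap_n B n).
    exact: measurable_mu_extE.
  exact: le_outer_measure.
apply/lee_addgt0Pr => _/posnumP[e]; near \oo => n.
have [mBn _ Pn] := BP n.
apply: (@le_trans _ _ (P (B n))).
  by rewrite le_measure ?inE//; exact: bigcap_inf.
apply: (le_trans Pn); rewrite leeD// lee_fin ltW//.
by near: n; exact: near_infty_natSinv_lt.
Unshelve. all: by end_near. Qed.

Lemma completed_measurableE :
  (P^*)%mu.-cara.-measurable = completed_algebra_gen P.
Proof.
apply/seteqP; split=> [E mE|_ [B mB [N [M [mM M0 NM]] <-]]].
  have [B [mB EB PB]] := outer_measurable_hull E.
  have [M [mM BEM PM]] := outer_measurable_hull (B `\` E).
  exists (B `\` M); first exact: measurableD.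
  exists (E `&` M); last first.
    apply/seteqP; split=> [x [[Bx nMx]|[]//]|x Ex].
      by apply: contrapT => nEx; apply: nMx; exact: BEM.
    by have [Mx|nMx] := pselect (M x); [right|left; split => //; exact: EB].
  exists M; split => //; rewrite PM.
  have PB' : (P^*)%mu B = (P^*)%mu E by rewrite -PB; exact: measurable_mu_extE.
  have h : (P^*)%mu E = (P^*)%mu E + (P^*)%mu (B `\` E).
    by rewrite -{1}PB' -[in X in X + _](setIidr EB); exact: mE.
  have fE : (P^*)%mu E \is a fin_num by rewrite -PB fin_num_measure.
  move: fE h; case: ((P^*)%mu E) => [r| |]//= _; case: ((P^*)%mu _) => [s| |]//=.
  by move=> [] /eqP; rewrite addrC -subr_eq subrr => /eqP <-.
apply: measurableU; first exact: caratheodory_measurable_mu_ext.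
apply: (@measure_is_complete_caratheodory _ _ (P^*)%mu).
exists M; split => //; first exact: caratheodory_measurable_mu_ext.
by rewrite -[RHS]M0; exact: measurable_mu_extE.
Qed.
End outer_measure_completion.

Section wiener.
Context {R : realType}.
Variable P : probability (C0 R) R.

(* F_T is the Caratheodory sigma-algebra of the outer measure of [P], which is
   the [P]-completion of the Borel sigma-algebra by [completed_measurableE]. *)
Definition completed_C0 := caratheodory_type (P^*)%mu.
Definition completion : set completed_C0 -> \bar R :=
  @completed_measure_extension _ _ _ P.
HB.instance Definition _ := Measure.on completion.

Lemma completion_setT : completion setT = 1%E.
Proof.
rewrite -(@probability_setT _ _ _ P) /completion /completed_measure_extension.
by rewrite measurable_mu_extE.
Qed.

HB.instance Definition _ :=
  Measure_isProbability.Build _ _ _ completion completion_setT.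


(* The coordinate process is a standard Brownian motion under [P]: Gaussian
   increments ([normal_prob] takes the standard deviation) that are mutually
   independent. The null start and path continuity are part of [C0 R]. *)
Definition wiener_measure : Prop :=
  (forall (s t : time R) (B : set R), val s < val t -> measurable B ->
     P [set w | B (w t - w s)] =
     normal_prob 0 (Num.sqrt (val t - val s)) B) /\
  (forall (n : nat) (t : nat -> time R) (B : nat -> set R),
     {homo t : i j / (i <= j)%N >-> val i <= val j} ->
     (forall i, measurable (B i)) ->
     P (\bigcap_(i in `I_n) [set w | B i (w (t i.+1) - w (t i))]) =
     (\prod_(i < n) P [set w | B i (w (t i.+1) - w (t i))%R])%E).

Local Notation "''E' [ X ]" := (expectation completion X%R).

(* L^p(R) and L^p(H): functions measurable for the completed sigma-algebra. *)
Definition Lp_real (p : R) (Z : C0 R -> R) : Prop :=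
  measurable_fun [set: completed_C0] Z /\
  ('E[fun w => `|Z w| `^ p] < +oo)%E.

Definition Lp_CM (p : R) (Z : C0 R -> CM R) : Prop :=
  measurable_fun [set: completed_C0] Z /\
  ('E[fun w => `|Z w| `^ p] < +oo)%E.

(* Deterministic step integrands sum_i a_i 1_{]t_i, t_{i+1}]} and their integral
   sum_i a_i (W_{t_{i+1}} - W_{t_i}). *)
Record simple_integrand := SimpleIntegrand {
  si_size : nat;
  si_time : nat -> time R;
  si_coef : nat -> R;
  si_mono : {homo si_time : i j / (i <= j)%N >-> val i <= val j} }.

Definition si_fun (s : simple_integrand) (x : R) : R :=
  \sum_(i < si_size s)
    si_coef s i * \1_(`]val (si_time s i), val (si_time s i.+1)]%classic) x.

Definition si_integral (s : simple_integrand) (w : C0 R) : R :=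
  \sum_(i < si_size s)
    si_coef s i * (w (si_time s i.+1) - w (si_time s i)).

(* [X] is a version of W(h) = int_0^1 h'(s) dW_s: an L^2(P)-limit of integrals
   of step functions that tend to h' in L^2([0, 1]). This determines [X] up to
   P-a.s. equality, so it is stated as a relation. *)
Definition wiener_integral (h : CM R) (X : C0 R -> R) : Prop :=
  measurable_fun [set: completed_C0] X /\
  exists s : nat -> simple_integrand,
    ((\int[lebesgue_measure]_(x in unit_itv R)
        ((cm_deriv h x - si_fun (s k) x) ^+ 2)%:E)%E @[k --> \oo] --> 0%E) /\
    ('E[fun w => (X w - si_integral (s k) w) ^+ 2] @[k --> \oo] --> 0%E).

(* [Z] belongs to S, and [DZ] is its Malliavin derivative: both are computed
   from the same representation Z = f(W(h_1), ..., W(h_n)). *)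
Definition smooth_rv (Z : C0 R -> R) (DZ : C0 R -> CM R) : Prop :=
  exists (n : nat) (h : 'I_n -> CM R) (X : 'I_n -> C0 R -> R)
    (f : mpoly.mpoly n R),
  [/\ (0 < n)%N,
      forall i, wiener_integral (h i) (X i),
      forall w, Z w = mpoly.meval (fun i => X i w) f &
      forall w, DZ w =
        \sum_(i < n) mpoly.meval (fun j => X j w) (mpoly.mderiv i f) *: h i].

Definition D1p (p : R) (Z : C0 R -> R) : Prop :=
  Lp_real p Z /\
  exists (Zn : nat -> C0 R -> R) (DZn : nat -> C0 R -> CM R),
  [/\ forall n, smooth_rv (Zn n) (DZn n),
      'E[fun w => `|Zn n w - Z w| `^ p] @[n --> \oo] --> 0%E &
      forall e : R, 0 < e -> exists N, forall m n, (N <= m)%N -> (N <= n)%N ->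
        ('E[fun w => `|DZn m w - DZn n w| `^ p] < e%:E)%E].

(* The expectation is extended-real valued: convergence to 0 includes that it
   is finite for small [eps]. *)
Definition SSGD (p : R) (Z : C0 R -> R) : Prop :=
  exists DZ : C0 R -> CM R, Lp_CM p DZ /\
  forall h : CM R,
    'E[fun w => `|(Z (tau (eps *: h) w) - Z w) / eps
                  - cm_inner (DZ w) h| `^ p] @[eps --> 0^'] --> 0%E.

End wiener.
Arguments completed_C0 {R} P.
Arguments completion {R} P _.
Arguments wiener_measure {R} P.
Arguments Lp_real {R} P p Z.
Arguments Lp_CM {R} P p Z.
Arguments wiener_integral {R} P h X.
Arguments smooth_rv {R} P Z DZ.
Arguments D1p {R} P p Z.
Arguments SSGD {R} P p Z.

(* Main.v *)
Require Import Defs.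
From mathcomp Require Import all_boot all_order all_algebra.
From mathcomp Require Import all_classical all_reals all_analysis.
From mathcomp Require Import measurable_realfun.
From mathcomp Require mpoly.
From mathcomp Require Import ring lra.
(* Only the canonical structures: the notations would clash. *)
Import (canonicals) mpoly.

Set Implicit Arguments.
Unset Strict Implicit.
Unset Printing Implicit Defensive.
Import Order.TTheory GRing.Theory Num.Theory.
Import numFieldNormedType.Exports.
Local Open Scope classical_set_scope.
Local Open Scope ring_scope.

(** The random variable has the form Z = f(W_1), so that the question is one
    about functions of a single standard Gaussian variable. Take f of the size
    of exp(x^2 / (2p)) times a negative power of |x|. The p-th power of the
    exponential cancels the Gaussian density exactly, and the negative power
    then makes f and f' p-integrable. The cancellation does not survive a
    translation: against the Gaussian density, |f(x + eps)|^p keeps a factor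
    exp(eps x), and E|f(W_1 + eps)|^p = +oo for every eps in ]0, 1]
    ([expectation_profile_shift]).

    For the direction h(t) = t, Z o tau_(eps h) = f(W_1 + eps). If Z had a
    derivative DZ in the strong sense, then for small eps > 0 the difference
    quotient minus <DZ, h> would be in L^p; as Z and <DZ, h> are in L^p, so
    would be Z o tau_(eps h), which contradicts the divergence above
    ([not_SSGD_counterexample]).

    Membership of Z in D^{1,p} requires polynomials that converge to f, with
    their derivatives, in L^p of the Gaussian law. A density theorem is avoided
    by choosing f as a power series with nonnegative coefficients: with
    u = x^2 / (2p),
      f(x) = sum_k u^k / (k+2)! = (exp u - 1 - u) / u^2.
    The partial sums of f and of f' are all bounded, uniformly in the number of
    terms, by one envelope C exp(u) / (1 + x^2), whose p-th power times the
    Gaussian density is at most a multiple of 1 / (1 + x^2)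
    ([expectation_envelope]). Dominated convergence in L^p then gives both
    convergences at once ([D1p_counterexample]). *)

(** * Partial sums of (exp u - 1 - u) / u^2 *)

Section shifted_exponential.
Context {R : realType}.
Implicit Types (u : R) (n k : nat).

(** Partial sums of (exp u - 1 - u) / u^2, the exponential series shifted by two
    ranks: the division by u^2 is what makes the p-th powers integrable later. *)
Definition shexp n u := \sum_(k < n) u ^+ k / k.+2`!%:R.
(** Partial sums of the derivative in u of the same series. *)
Definition dshexp n u := \sum_(k < n) k.+1%:R * u ^+ k / k.+3`!%:R.

Lemma factr_gt0 k : 0 < k`!%:R :> R.
Proof. by rewrite ltr0n fact_gt0. Qed.

Lemma factV_le j k : (j <= k)%N -> (k`!%:R : R)^-1 <= j`!%:R^-1.
Proof.
move=> jk; rewrite lef_pV2 ?posrE ?factr_gt0// ler_nat.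
exact: leq_fact.
Qed.

Lemma series_exp_coeff_le n u : 0 <= u -> \sum_(k < n) u ^+ k / k`!%:R <= expR u.
Proof.
move=> u0; rewrite -(big_mkord xpredT (fun k => u ^+ k / k`!%:R)).
apply: (nondecreasing_cvgn_le _ (is_cvg_series_exp_coeff u)).
by apply: nondecreasing_series => k _ _; exact: exp_coeff_ge0.
Qed.

Lemma shexp_ge0 n u : 0 <= u -> 0 <= shexp n u.
Proof. by move=> u0; apply: sumr_ge0 => k _; rewrite divr_ge0 ?exprn_ge0. Qed.

Lemma dshexp_ge0 n u : 0 <= u -> 0 <= dshexp n u.
Proof.
by move=> u0; apply: sumr_ge0 => k _; rewrite divr_ge0 ?mulr_ge0 ?exprn_ge0.
Qed.

Lemma shexp_nd u : 0 <= u -> nondecreasing_seq (shexp ^~ u).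
Proof.
move=> u0; apply/nondecreasing_seqP => n.
by rewrite /shexp big_ord_recr lerDl divr_ge0 ?exprn_ge0.
Qed.

Lemma dshexp_nd u : 0 <= u -> nondecreasing_seq (dshexp ^~ u).
Proof.
move=> u0; apply/nondecreasing_seqP => n.
by rewrite /dshexp big_ord_recr lerDl divr_ge0 ?mulr_ge0 ?exprn_ge0.
Qed.

(** Termwise, because (k+1) / (k+3)! <= 1 / (k+2)!. *)
Lemma dshexp_le_shexp n u : 0 <= u -> dshexp n u <= shexp n u.
Proof.
move=> u0; apply: ler_sum => k _.
rewrite (factS k.+2) natrM invfM mulrACA ler_piMl ?divr_ge0 ?exprn_ge0//.
by rewrite ler_pdivrMr ?ltr0n// mul1r ler_nat ltnW.
Qed.

(** Both the sum and its product by u^2 are termwise below partial sums of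
    the exponential series. *)
Lemma shexp_ub n u : 0 <= u -> (1 + u ^+ 2) * shexp n u <= 2 * expR u.
Proof.
move=> u0; rewrite mulrDl mul1r mulr_natl mulr2n lerD//.
  apply: le_trans (series_exp_coeff_le n u0); apply: ler_sum => k _.
  by rewrite ler_wpM2l ?exprn_ge0// factV_le// (leq_trans (leqnSn k)).
apply: le_trans (series_exp_coeff_le n.+2 u0).
rewrite [leRHS]big_ord_recl [in leRHS]big_ord_recl addrA ler_wpDl//.
  by rewrite addr_ge0// divr_ge0 ?exprn_ge0.
rewrite mulr_sumr; apply: ler_sum => k _.
by rewrite mulrA -exprD.
Qed.

(** The partial sum of exp is 1 + u plus u^2 times the shifted
    sum, and 1 + u is absorbed because the shifted sum is at least its first
    term 1/2. Letting n tend to infinity bounds the profile from below by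
    exp u over a polynomial, without a division by u^2. *)
Lemma shexp_lb n u : 0 <= u ->
  \sum_(k < n.+3) u ^+ k / k`!%:R <= (u ^+ 2 + 2 * u + 2) * shexp n.+1 u.
Proof.
move=> u0; rewrite [leLHS]big_ord_recl [in leLHS]big_ord_recl addrA.
have -> : (u ^+ 2 + 2 * u + 2) * shexp n.+1 u =
  (2 * u + 2) * shexp n.+1 u + u ^+ 2 * shexp n.+1 u by ring.
rewrite lerD//; last first.
  by rewrite mulr_sumr; apply: ler_sum => k _; rewrite mulrA -exprD.
have : 2^-1 <= shexp n.+1 u.
  rewrite /shexp big_ord_recl expr0 mul1r lerDl.
  by apply: sumr_ge0 => k _; rewrite divr_ge0 ?exprn_ge0.
by rewrite /= expr0 expr1 !divr1; nra.
Qed.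
End shifted_exponential.

(** * The profile, its polynomial approximations and their envelope *)

Section profile.
Context {R : realType} (p : R).
Hypothesis p1 : 1 < p.
Implicit Types x : R.

Let p0 : 0 < p. Proof. exact: lt_trans p1. Qed.

Definition gauss_exponent x := x ^+ 2 / (2 * p).

Definition profile_poly n : {poly R} :=
  \sum_(k < n) ((2 * p) ^- k / k.+2`!%:R) *: 'X^(2 * k).

(** The function f of the construction; everywhere convergent by
    [is_cvg_profile_poly]. *)
Definition profile x : R := limn (fun n => (profile_poly n).[x]).

(** The constant is what the proof of [shexp_le_envelope] produces. *)
Definition envelope x := 16 * p ^+ 2 * expR (gauss_exponent x) / (1 + x ^+ 2).

Lemma gauss_exponent_ge0 x : 0 <= gauss_exponent x.
Proof. by rewrite divr_ge0 ?sqr_ge0// mulr_ge0// ltW. Qed.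

Lemma envelope_ge0 x : 0 <= envelope x.
Proof.
rewrite divr_ge0 ?addr_ge0 ?sqr_ge0//.
by rewrite mulr_ge0 ?expR_ge0// mulr_ge0 ?sqr_ge0.
Qed.

Lemma horner_profile n x : (profile_poly n).[x] = shexp n (gauss_exponent x).
Proof.
rewrite horner_sum; apply: eq_bigr => k _.
by rewrite hornerZ hornerXn /gauss_exponent expr_div_n exprM mulrC mulrA.
Qed.

(** Chain rule, with u' = x / p. One more term is taken on the left because the
    constant term disappears. *)
Lemma horner_deriv_profile n x :
  (profile_poly n.+1)^`().[x] = x / p * dshexp n (gauss_exponent x).
Proof.
rewrite /profile_poly big_ord_recl derivD muln0 derivZ derivXn mulr0n scaler0 add0r.
rewrite raddf_sum horner_sum mulr_sumr; apply: eq_bigr => k _.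
rewrite /= derivZ derivXn (_ : 2 * bump 0 k = (2 * k).+2)%N; last first.
  by rewrite /bump leq0n add1n mulnS.
rewrite hornerZ hornerMn hornerXn /gauss_exponent expr_div_n /bump leq0n add1n.
rewrite -exprM /= !exprS invfM -[_ *+ (2 * k).+2]mulr_natr.
have -> : ((2 * k).+2%:R : R) = 2 * k.+1%:R by rewrite -natrM mulnS.
have ? : (k.+3)`!%:R != 0 :> R by rewrite gt_eqF// factr_gt0.
have ? : (2 * p) ^+ k != 0 by rewrite expf_neq0// gt_eqF// mulr_gt0.
have pn : p != 0 by rewrite gt_eqF.
by field; apply/and3P; split.
Qed.

(** The extra factor 1 + x^2 on the left serves twice: it is dropped to bound
    the profile, and it dominates the factor |x| / p of the derivative. It is
    available because the shifted series gains u^2, that is, four powers of x,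
    of which the envelope uses only two. *)
Lemma shexp_le_envelope n x :
  (1 + x ^+ 2) * shexp n (gauss_exponent x) <= envelope x.
Proof.
set u := gauss_exponent x; have u0 : 0 <= u := gauss_exponent_ge0 x.
have x2 : x ^+ 2 = 2 * p * u.
  by rewrite /u /gauss_exponent mulrC divfK// gt_eqF// mulr_gt0.
rewrite ler_pdivlMr ?ltr_wpDr ?sqr_ge0// mulrAC.
have := shexp_ub n u0; have := shexp_ge0 n u0; move: (shexp n u) => g g0 gu.
have h : (1 + x ^+ 2) * (1 + x ^+ 2) <= 8 * p ^+ 2 * (1 + u ^+ 2).
  have : 1 + x ^+ 2 <= 2 * p * (1 + u) by rewrite x2 mulrDr mulr1 lerD2r; have := p1; lra.
  have : 0 <= 1 + x ^+ 2 by rewrite addr_ge0 ?sqr_ge0.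
  move=> a b; apply: (@le_trans _ _ ((2 * p * (1 + u)) * (2 * p * (1 + u)))).
    by rewrite ler_pM.
  by have := sqr_ge0 (1 - u); have := sqr_ge0 p; nra.
apply: le_trans (ler_wpM2r g0 h) _.
by rewrite -mulrA; have := ler_wpM2l (sqr_ge0 p) gu; lra.
Qed.

Lemma profile_poly_le_envelope n x : `|(profile_poly n).[x]| <= envelope x.
Proof.
have g0 := shexp_ge0 n (gauss_exponent_ge0 x).
rewrite horner_profile ger0_norm//; apply: le_trans (shexp_le_envelope n x).
by rewrite ler_peMl// lerDl sqr_ge0.
Qed.

Lemma deriv_profile_poly_le_envelope n x :
  `|(profile_poly n.+1)^`().[x]| <= envelope x.
Proof.
have u0 := gauss_exponent_ge0 x.
have g0 := shexp_ge0 n u0.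
rewrite horner_deriv_profile normrM (ger0_norm (dshexp_ge0 n u0)).
apply: le_trans (shexp_le_envelope n x); rewrite ler_pM ?dshexp_le_shexp ?dshexp_ge0//.
rewrite normf_div (ger0_norm (ltW p0)) ler_pdivrMr//.
have : 2 * `|x| <= 1 + x ^+ 2.
  by rewrite -[x ^+ 2]real_normK ?num_real//; have := sqr_ge0 (1 - `|x|); nra.
move=> x2; apply: (@le_trans _ _ (1 + x ^+ 2)).
  by have := normr_ge0 x; lra.
by rewrite ler_peMr ?addr_ge0 ?sqr_ge0// ltW.
Qed.

(** Partial sums of nonnegative terms, bounded by the envelope. *)
Lemma is_cvg_profile_poly x : cvgn (fun n => (profile_poly n).[x]).
Proof.
apply: nondecreasing_is_cvgn.
  move=> m n mn; rewrite !horner_profile; apply: shexp_nd => //.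
  exact: gauss_exponent_ge0.
exists (envelope x) => _ [n _ <-].
exact: le_trans (ler_norm _) (profile_poly_le_envelope _ _).
Qed.

Lemma is_cvg_deriv_profile_poly x :
  cvgn (fun n => (profile_poly n.+1)^`().[x]).
Proof.
have u0 := gauss_exponent_ge0 x.
under eq_fun do rewrite horner_deriv_profile.
apply: is_cvgMl_tmp; apply: nondecreasing_is_cvgn.
  by move=> m n mn; apply: dshexp_nd.
exists (envelope x) => _ [n _ <-]; apply: le_trans (dshexp_le_shexp n u0) _.
rewrite -horner_profile.
exact: le_trans (ler_norm _) (profile_poly_le_envelope _ _).
Qed.

Lemma profile_lb x :
  expR (gauss_exponent x) <=
  (gauss_exponent x ^+ 2 + 2 * gauss_exponent x + 2) * profile x.
Proof.
set u := gauss_exponent x; have u0 : 0 <= u := gauss_exponent_ge0 x.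
have eu : \sum_(k < n.+3) u ^+ k / k`!%:R @[n --> \oo] --> expR u.
  have := is_cvg_series_exp_coeff u; rewrite -(cvg_shiftn 3).
  by under eq_fun do rewrite /series/= big_mkord addn3.
have gu : (u ^+ 2 + 2 * u + 2) * shexp n.+1 u @[n --> \oo] -->
    (u ^+ 2 + 2 * u + 2) * profile x.
  apply: cvgMl_tmp; rewrite (cvg_shiftS (shexp ^~ u)).
  have e : (fun n => (profile_poly n).[x]) = shexp ^~ u.
    by apply/funext => n; rewrite horner_profile.
  by have := @is_cvg_profile_poly x; rewrite /profile e.
by apply: (ler_cvg_to eu gu); apply: nearW => n; exact: shexp_lb.
Qed.

Lemma measurable_profile : measurable_fun setT profile.
Proof.
apply: (@measurable_fun_cvg _ _ R setT (fun n x => (profile_poly n).[x])).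
  by move=> n; exact: measurable_poly.
by move=> x _; exact: is_cvg_profile_poly.
Qed.

Lemma profile_le_envelope x : `|profile x| <= envelope x.
Proof.
apply: (@ler_cvg_to _ _ _ R _ _ _ _ (cvg_norm (@is_cvg_profile_poly x))
  (cvg_cst (envelope x))).
by apply: nearW => n; exact: profile_poly_le_envelope.
Qed.

End profile.

(** * The law of the endpoint of Brownian motion *)

Section gauss.
Context {R : realType}.
Local Notation mu := (@lebesgue_measure R).

(** The density of the normal law is a.e. its Radon-Nikodym derivative, since
    both have the same integral over every measurable set. *)
Lemma ge0_integral_normal_prob (m s : R) (f : R -> \bar R) :
  measurable_fun setT f -> (forall x, (0 <= f x)%E) ->
  (\int[normal_prob m s]_x f x = \int[mu]_x (f x * (normal_pdf m s x)%:E))%E.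
Proof.
move=> mf f0; have dom := normal_prob_dominates m s.
rewrite -(Radon_Nikodym_SigmaFinite.change_of_variables dom f0)//.
have iD := Radon_Nikodym_SigmaFinite.f_integrable dom.
have mpdf : measurable_fun setT (fun x => (normal_pdf m s x)%:E).
  by apply/measurable_EFinP; exact: measurable_normal_pdf.
apply: ae_eq_integral => //.
- by apply: emeasurable_funM => //; exact: measurable_int iD.
- exact: emeasurable_funM.
- apply: ae_eqe_mul2l; apply: integral_ae_eq => // E _ mE.
  by rewrite -(Radon_Nikodym_SigmaFinite.f_integral dom).
Qed.

Lemma integral_oneDsqr_fin :
  (\int[mu]_x ((1 + x ^+ 2)^-1)%:E < +oo)%E.
Proof.
rewrite (ge0_symfun_integralT (f := fun x => (oneDsqr x)^-1)).
- rewrite (_ : [set x | _] = `[0, +oo[%classic).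
    by rewrite integral0y_oneDsqr -EFinM ltry.
  by apply/seteqP; split => x/=; rewrite in_itv/= andbT.
- by move=> x; rewrite invr_ge0.
- exact: continuous_oneDsqrV.
- by move=> x; rewrite /= /oneDsqr sqrrN.
Qed.

End gauss.

Lemma continuous_borel_measurable (R : realType) (T : ptopologicalType)
    (f : T -> R) : continuous f ->
  measurable_fun [set: g_sigma_algebraType (@open T)]
    (f : g_sigma_algebraType (@open T) -> R).
Proof.
move=> cf; apply: (measurability _ (RGenOpens.measurableE R)) => _ [_ [a [b ->]] <-].
rewrite setTI; apply: sub_sigma_algebra.
apply: open_comp => [x _|]; [exact: cf|exact: interval_open].
Qed.

Section wiener_marginal.
Context {R : realType} (P : probability (C0 R) R).
Hypothesis hP : wiener_measure P.
Local Notation mu := (@lebesgue_measure R).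

Lemma time1_subproof : (1 : R) \in unit_itv R.
Proof. by rewrite mem_setE in_itv/= lexx ler01. Qed.
Definition time1 : time R := exist _ 1 time1_subproof.

(** The topology of the path space is uniform convergence, which is finer than
    pointwise convergence. *)
Lemma C0_eval_continuous (t : time R) : continuous (fun w : C0 R => w t).
Proof.
have cu (f : {uniform time R -> R}) :
    {for f, continuous (fun g : {uniform time R -> R} => g t)}.
  move=> B /nbhs_ballP[e /= e0 eB]; apply/uniform_nbhs.
  exists [set xy | ball xy.1 e xy.2]; split.
    exact: entourage_ball (PosNum e0).
  by move=> g /(_ t I) /eB.
move=> w; apply: (@continuous_comp (C0 R) {uniform time R -> R} R
  (@path_uniform R) (fun g => g t)).
  exact: initial_continuous.
exact: cu.
Qed.

Lemma measurable_C0_eval (t : time R) :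
  measurable_fun [set: completed_C0 P] (fun w : C0 R => w t).
Proof.
move=> _ B mB; rewrite setTI; apply: caratheodory_measurable_mu_ext.
have := continuous_borel_measurable (@C0_eval_continuous t).
by move=> /(_ measurableT _ mB); rewrite setTI.
Qed.

(** The increment between times 0 and 1 is the value at time 1, as paths start
    from 0; the completed measure agrees with P on Borel sets. *)
Lemma wiener_marginal1 B : measurable B ->
  completion P [set w | B (w time1)] = normal_prob 0 1 B.
Proof.
move=> mB; have := hP.1 time0 time1 B; rewrite /= ltr01 subr0 sqrtr1 => <-//.
have mE : measurable [set w : C0 R | B (w time1)].
  have := continuous_borel_measurable (@C0_eval_continuous time1).
  by move=> /(_ measurableT _ mB); rewrite setTI.
rewrite [LHS](measurable_mu_extE P mE); congr (P _).
by apply/seteqP; split => w /=; rewrite C0_time0 subr0.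
Qed.

(** Moments of functions of W_1 become Lebesgue integrals in which the Gaussian
    density appears explicitly and can cancel against the exponentials. *)
Lemma expectation_W1 (f : R -> R) : measurable_fun setT f -> (forall x, 0 <= f x) ->
  expectation (completion P) (fun w : C0 R => f (w time1)) =
  (\int[mu]_x (f x * normal_pdf 0 1 x)%:E)%E.
Proof.
move=> mf f0; rewrite unlock.
(* The normal law lives on the line with its generated sigma-algebra, so the
   codomain and the integrand are typed accordingly before pushing forward. *)
pose W1 : completed_C0 P -> measurableTypeR R := fun w => w time1.
have mW1 : measurable_fun setT W1 := @measurable_C0_eval time1.
pose g : measurableTypeR R -> \bar R := EFin \o f.
have mg : measurable_fun setT g by apply/measurable_EFinP.
have := ge0_integral_pushforward mW1 (completion P) measurableT mg (fun x _ => f0 x).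
rewrite preimage_setT => <-.
under [RHS]eq_integral do rewrite EFinM.
rewrite -(ge0_integral_normal_prob 0 1 mg) => [|x]; last by rewrite lee_fin.
by apply: eq_measure_integral => B mB _; exact: wiener_marginal1.
Qed.
End wiener_marginal.

(** * Absolute moments of order p *)

Section powR.
Context {R : realType}.
Implicit Types (p a b : R).

(** Bound |a + b| by twice the larger of |a| and |b|; cruder than convexity, but
    valid for all p >= 0. *)
Lemma powR_normD p a b : 0 <= p ->
  `|a + b| `^ p <= 2 `^ p * (`|a| `^ p + `|b| `^ p).
Proof.
move=> p0; have step c d : `|c| <= `|d| ->
    `|c + d| `^ p <= 2 `^ p * (`|c| `^ p + `|d| `^ p).
  move=> cd; apply: (@le_trans _ _ ((2 * `|d|) `^ p)).
    rewrite ge0_ler_powR ?nnegrE ?mulr_ge0// (le_trans (ler_normD _ _))//.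
    by rewrite mulr_natl mulr2n lerD2r.
  by rewrite powRM// ler_wpM2l ?powR_ge0// lerDr powR_ge0.
have [/step//|/ltW/step] := leP `|a| `|b|.
by rewrite addrC [in leRHS]addrC.
Qed.

(** As p >= 1, |y|^p <= |y| as soon as |y| <= 1. *)
Lemma cvg_powR_norm0 p (y : nat -> R) : 1 <= p -> y n @[n --> \oo] --> 0 ->
  `|y n| `^ p @[n --> \oo] --> 0.
Proof.
move=> p1 y0; have ny0 : `|y n| @[n --> \oo] --> 0.
  by have := cvg_norm y0; rewrite normr0; exact.
apply: (@squeeze_cvgr _ _ _ _ (cst 0) (fun n => `|y n|)); [|exact: cvg_cst|]; last first.
  exact: ny0.
near=> n; have yn : `|y n| <= 1 by near: n; exact: cvgr0_norm_le.
rewrite powR_ge0/=; have [->|yn0] := eqVneq (y n) 0.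
  by rewrite normr0 powR0// gt_eqF// (lt_le_trans ltr01).
by rewrite ge1r_powR// normr_gt0 yn0.
Unshelve. all: by end_near. Qed.

End powR.

Section expectation.
Context d (T : measurableType d) (R : realType) (P : probability T R).
Implicit Types (X : T -> R).

Lemma measurable_powR_norm p X : measurable_fun setT X ->
  measurable_fun setT (fun w => `|X w| `^ p).
Proof.
move=> mX; apply: (measurableT_comp (measurable_powR p)).
exact: measurableT_comp.
Qed.

Lemma ge0_le_expectation (X Y : T -> R) :
  measurable_fun setT X -> measurable_fun setT Y ->
  (forall w, 0 <= X w <= Y w) -> (expectation P X <= expectation P Y)%E.
Proof.
move=> mX mY XY; rewrite !unlock; apply: ge0_le_integral => //.
- by move=> w _; rewrite lee_fin; case/andP: (XY w).
- exact/measurable_EFinP.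
- exact/measurable_EFinP.
- by move=> w _; rewrite lee_fin; case/andP: (XY w).
Qed.

Lemma expectation_powR_normD p X Y : 0 <= p ->
  measurable_fun setT X -> measurable_fun setT Y ->
  (expectation P (fun w => `|X w + Y w| `^ p)%R <=
   (2 `^ p)%:E * (expectation P (fun w => `|X w| `^ p)%R +
                  expectation P (fun w => `|Y w| `^ p)%R))%E.
Proof.
move=> p0 mX mY.
have mXp := measurable_powR_norm p mX; have mYp := measurable_powR_norm p mY.
apply: le_trans (ge0_le_expectation (Y := fun w => 2 `^ p * (`|X w| `^ p + `|Y w| `^ p)) _ _ _) _.
- exact/measurable_powR_norm/measurable_funD.
- by apply: measurable_funM => //; exact: measurable_funD.
- by move=> w; rewrite powR_ge0 powR_normD.
rewrite !unlock; under eq_integral do rewrite EFinM.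
rewrite ge0_integralZl//=.
- rewrite -ge0_integralD//=.
  + by apply/measurable_EFinP.
  + by apply/measurable_EFinP.
- by apply/measurable_EFinP; exact: measurable_funD.
Qed.

Lemma expectation_powR_normZ p (a : R) X : measurable_fun setT X ->
  (expectation P (fun w => `|a * X w| `^ p)%R =
   (`|a| `^ p)%:E * expectation P (fun w => `|X w| `^ p)%R)%E.
Proof.
move=> mX; rewrite !unlock; under eq_integral do rewrite normrM powRM// EFinM.
rewrite ge0_integralZl//= ?lee_fin ?powR_ge0//.
by apply/measurable_EFinP; exact: measurable_powR_norm.
Qed.

(** The limit obeys the same bound B, so |u_n - v|^p is dominated by 2^p B^p and
    the ordinary dominated convergence theorem applies to it. *)
Lemma dominated_convergence_Lp p (u : nat -> T -> R) (v B : T -> R) : 1 <= p ->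
  (forall n, measurable_fun setT (u n)) -> measurable_fun setT B ->
  (forall w, u n w @[n --> \oo] --> v w) ->
  (forall n w, `|u n w| <= B w) ->
  (expectation P (fun w => `|B w| `^ p)%R < +oo)%E ->
  (expectation P (fun w => `|u n w - v w| `^ p)%R @[n --> \oo] --> 0)%E.
Proof.
move=> p1 mu mB uv uB Bfin; have p0 : 0 <= p by exact: le_trans p1.
have mv : measurable_fun setT v by apply: (measurable_fun_cvg mu) => w _; exact: uv.
have vB w : `|v w| <= B w.
  apply: (ler_cvg_to (cvg_norm (uv w)) (cvg_cst (B w))).
  exact: nearW.
have mf n : measurable_fun setT (EFin \o (fun w => `|u n w - v w| `^ p)).
  by apply/measurable_EFinP/measurable_powR_norm; exact: measurable_funB.
have iB : P.-integrable setT (EFin \o (fun w => 2 `^ p * `|B w| `^ p)).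
  have mBp := measurable_powR_norm p mB.
  have : P.-integrable setT (EFin \o (fun w => `|B w| `^ p)).
    apply/integrableP; split; first exact/measurable_EFinP.
    move: Bfin; rewrite unlock; under [X in (_ -> X < _)%E]eq_integral do
      rewrite gee0_abs ?lee_fin ?powR_ge0//.
    by [].
  by move=> /(integrableZl measurableT (2 `^ p)).
have [] := @dominated_convergence _ _ _ P setT measurableT
  (fun n => EFin \o (fun w => `|u n w - v w| `^ p)) (cst 0%E) _ mf _ _ iB _.
- exact: measurable_cst.
- apply: aeW => w _ /=; apply: cvg_EFin; first exact: nearW.
  apply: cvg_powR_norm0 => //.
  by rewrite -(subrr (v w)); apply: cvgB => //; exact: cvg_cst.
- apply: aeW => w n _ /=; rewrite lee_fin ger0_norm ?powR_ge0//.
  have B0 : 0 <= B w by exact: le_trans (uB n w).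
  rewrite -powRM// ge0_ler_powR ?nnegrE ?mulr_ge0//.
  rewrite (ger0_norm B0) (le_trans (ler_normB _ _))//.
  by rewrite mulr_natl mulr2n lerD.
move=> _ _; rewrite integral0; apply: cvg_trans; apply: near_eq_cvg.
by apply: nearW => n; rewrite unlock.
Qed.
(** The hypothesis bounds the distance to [v], so the triangle inequality up to
    the factor 2^p is enough; it accounts for the constant in the choice of r. *)
Lemma Lp_Cauchy p (u : nat -> T -> R) (v : T -> R) : 0 <= p ->
  (forall n, measurable_fun setT (u n)) -> measurable_fun setT v ->
  (expectation P (fun w => `|u n w - v w| `^ p)%R @[n --> \oo] --> 0)%E ->
  forall e : R, 0 < e -> exists N, forall m n, (N <= m)%N -> (N <= n)%N ->
    (expectation P (fun w => `|u m w - u n w| `^ p)%R < e%:E)%E.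
Proof.
move=> p0 mu mv uv e e0.
pose r := e / (2 `^ p * 3).
have r0 : 0 < r by rewrite divr_gt0// mulr_gt0// powR_gt0.
have [N _ uN] : \forall n \near \oo,
    (expectation P (fun w => `|u n w - v w| `^ p)%R <= r%:E)%E.
  have /fine_cvgP[fin] := uv.
  move=> /cvgrPdist_le /(_ _ r0); apply: filterS2 fin => n fn /=.
  rewrite sub0r normrN => /(le_trans (ler_norm _)).
  by rewrite -lee_fin fineK.
exists N => m n Nm Nn.
have mB k : measurable_fun setT (fun w => u k w - v w) by exact: measurable_funB.
have mB' k : measurable_fun setT (fun w => v w - u k w) by exact: measurable_funB.
rewrite (_ : (fun w => _) = (fun w => `|(u m w - v w) + (v w - u n w)| `^ p)); last first.
  by apply/funext => w; rewrite addrA subrK.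
apply: le_lt_trans (expectation_powR_normD p0 (mB m) (mB' n)) _.
rewrite (_ : (fun w => `|v w - u n w| `^ p) = (fun w => `|u n w - v w| `^ p)); last first.
  by apply/funext => w; rewrite distrC.
apply: (@le_lt_trans _ _ ((2 `^ p)%:E * (r%:E + r%:E))%E).
  by rewrite lee_wpmul2l ?lee_fin ?powR_ge0// leeD// uN.
rewrite -EFinD -EFinM lte_fin /r.
have k0 : 0 < 2 `^ p by rewrite powR_gt0.
have -> : 2 `^ p * (e / (2 `^ p * 3) + e / (2 `^ p * 3)) = e * (2 / 3).
  by move: (2 `^ p) k0 => k k0; field; rewrite gt_eqF.
by rewrite gtr_pMr//; lra.
Qed.

End expectation.

(** * The profile under the Gaussian law *)

Section profile_expectation.
Context {R : realType} (P : probability (C0 R) R) (p : R).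
Hypotheses (hP : wiener_measure P) (p1 : 1 < p).
Let p0 : 0 < p. Proof. exact: lt_trans p1. Qed.

Lemma normal_pdf01 x : normal_pdf 0 1 x = normal_peak 1 * expR (- (x ^+ 2 / 2)) :> R.
Proof.
rewrite normal_pdfE ?oner_eq0// /normal_fun subr0 expr1n mulNr.
by congr (_ * expR (- (_ / _))).
Qed.

(** The p-th power of exp(x^2 / (2p)) is exp(x^2 / 2), the inverse of the
    Gaussian density up to a constant. *)
Lemma gauss_exponentM x : gauss_exponent p x * p = x ^+ 2 / 2.
Proof. by rewrite /gauss_exponent; field; rewrite gt_eqF. Qed.

Lemma measurable_envelope : measurable_fun setT (envelope p).
Proof.
apply: measurable_funM.
  apply: measurable_funM => //; apply: measurableT_comp => //.
  by apply: measurable_funM => //; exact: measurable_funX.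
apply: continuous_measurable_fun; exact: continuous_oneDsqrV.
Qed.

(** After the cancellation of the exponentials the integrand is a constant times
    (1 + x^2)^-p, which is at most (1 + x^2)^-1 because p >= 1. *)
Lemma expectation_envelope :
  (expectation (completion P)
     (fun w : C0 R => `|envelope p (w time1)| `^ p)%R < +oo)%E.
Proof.
rewrite (expectation_W1 hP (f := fun x => `|envelope p x| `^ p)); first last.
- by move=> x; exact: powR_ge0.
  by apply: measurable_powR_norm; exact: measurable_envelope.
pose c := (16 * p ^+ 2) `^ p * normal_peak 1.
apply: (@le_lt_trans _ _ (\int[lebesgue_measure]_x (c%:E * ((1 + x ^+ 2)^-1)%:E))%E).
  apply: ge0_le_integral => //.
  - by move=> x _; rewrite lee_fin mulr_ge0 ?powR_ge0 ?normal_pdf_ge0.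
  - apply/measurable_EFinP/measurable_funM; last exact: measurable_normal_pdf.
    by apply: measurable_powR_norm; exact: measurable_envelope.
  - apply/measurable_EFinP/measurable_funM => //.
    by apply: continuous_measurable_fun; exact: continuous_oneDsqrV.
  - move=> x _; rewrite -EFinM lee_fin.
    have y0 : 0 < 1 + x ^+ 2 by rewrite ltr_pwDl ?sqr_ge0.
    rewrite ger0_norm ?envelope_ge0// /envelope powRM ?invr_ge0 ?(ltW y0)//; last first.
      by rewrite mulr_ge0 ?expR_ge0// mulr_ge0 ?sqr_ge0.
    rewrite powRM ?expR_ge0//; last by rewrite mulr_ge0 ?sqr_ge0.
    rewrite -expRM gauss_exponentM normal_pdf01 /c.
    rewrite (_ : _ * _ * _ * _ = (16 * p ^+ 2) `^ p * normal_peak 1 * (1 + x ^+ 2)^-1 `^ p); last first.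
      have : expR (x ^+ 2 / 2) * expR (- (x ^+ 2 / 2)) = 1 by rewrite -expRD subrr expR0.
      by move=> e; rewrite -[RHS]mulr1 -[X in _ = _ * X]e; ring.
    rewrite ler_wpM2l ?mulr_ge0 ?powR_ge0 ?normal_peak_ge0//.
    by rewrite ge1r_powR ?invr_gt0 ?y0 ?invf_le1 ?lerDl ?sqr_ge0//= ltW.
rewrite ge0_integralZl//.
- rewrite lte_mul_pinfty ?lee_fin ?mulr_ge0 ?powR_ge0 ?normal_peak_ge0//.
  exact: integral_oneDsqr_fin.
- apply/measurable_EFinP.
  by apply: continuous_measurable_fun; exact: continuous_oneDsqrV.
- by move=> x _; rewrite lee_fin invr_ge0 addr_ge0 ?sqr_ge0.
- by rewrite lee_fin mulr_ge0 ?powR_ge0 ?normal_peak_ge0.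
Qed.

End profile_expectation.

Section divergence.
Context {R : realType} (P : probability (C0 R) R) (p : R).
Hypotheses (hP : wiener_measure P) (p1 : 1 < p).
Let p0 : 0 < p. Proof. exact: lt_trans p1. Qed.

(** Expanding (x + eps)^2 shows that the translation gains the factor
    exp(eps x / p), which beats the polynomial loss of [profile_lb]. Only a
    constant lower bound is needed: the loss is at most 50 x^4, and
    exp(eps x / p) = exp(eps x / (4p))^4 >= (eps x / (4p))^4. *)
Lemma profile_shift_lb eps x : 0 < eps <= 1 -> 1 <= x ->
  (eps / (4 * p)) ^+ 4 / 50 * expR (gauss_exponent p x) <= profile p (x + eps).
Proof.
move=> /andP[e0 e1] x1; have x0 : 0 < x by exact: lt_le_trans x1.
set u := gauss_exponent p (x + eps).
have u0 : 0 <= u by exact: gauss_exponent_ge0.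
have u4 : u <= 4 * x ^+ 2.
  rewrite /u /gauss_exponent ler_pdivrMr ?mulr_gt0//.
  have h : (x + eps) ^+ 2 <= 4 * x ^+ 2 by nra.
  by apply: (le_trans h); rewrite ler_peMr ?mulr_ge0 ?sqr_ge0//; have := p1; lra.
have f0 : 0 <= profile p (x + eps).
  have := le_trans (expR_ge0 u) (profile_lb p1 (x + eps)).
  by rewrite pmulr_rge0// -/u ltr_wpDl// addr_ge0 ?sqr_ge0// mulr_ge0.
have ub : u ^+ 2 + 2 * u + 2 <= 50 * x ^+ 4.
  have x2 : 1 <= x ^+ 2 by rewrite exprn_ege1.
  rewrite (_ : x ^+ 4 = x ^+ 2 * x ^+ 2); last by rewrite -exprD.
  by move: (x ^+ 2) x2 u4 => y y1 u4; nra.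
have key : expR (gauss_exponent p x) * (eps * x / (4 * p)) ^+ 4 <= expR u.
  apply: (@le_trans _ _ (expR (gauss_exponent p x) * expR (eps * x / (4 * p)) ^+ 4)).
    rewrite ler_wpM2l ?expR_ge0// lerXn2r ?nnegrE ?expR_ge0//.
      by rewrite divr_ge0 ?mulr_ge0 ?ltW.
    by apply: le_trans (expR_ge1Dx _); rewrite lerDr.
  rewrite -expRM_natl -expRD ler_expR /u /gauss_exponent.
  rewrite -subr_ge0 (_ : _ - _ = eps ^+ 2 / (2 * p)); last by field; rewrite gt_eqF.
  by rewrite divr_ge0 ?sqr_ge0// mulr_ge0// ltW.
have lb := le_trans key (le_trans (profile_lb p1 (x + eps)) (ler_wpM2r f0 ub)).
have x4 : 0 < 50 * x ^+ 4 by rewrite mulr_gt0 ?exprn_gt0.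
rewrite -(ler_pM2l x4) (le_trans _ lb)//.
rewrite le_eqVlt; apply/orP; left; apply/eqP; field.
by rewrite gt_eqF.
Qed.

(** By [profile_shift_lb], the integrand is bounded below by a positive constant
    on [1, +oo[, a set of infinite Lebesgue measure. *)
Lemma expectation_profile_shift eps : 0 < eps <= 1 ->
  (expectation (completion P)
     (fun w : C0 R => `|profile p (w time1 + eps)| `^ p)%R = +oo)%E.
Proof.
move=> e01; have mf : measurable_fun setT (fun x : R => `|profile p (x + eps)| `^ p).
  apply: measurable_powR_norm; apply: (measurableT_comp (measurable_profile p1)).
  exact: measurable_funD.
rewrite (expectation_W1 hP mf) => [|x]; last exact: powR_ge0.
pose c := (eps / (4 * p)) ^+ 4 / 50.
have c0 : 0 < c.
  by case/andP: e01 => e0 _; rewrite divr_gt0// exprn_gt0// divr_gt0// mulr_gt0.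
have k0 : 0 < c `^ p * normal_peak 1.
  by rewrite mulr_gt0 ?powR_gt0 ?normal_peak_gt0 ?oner_eq0.
have mg : measurable_fun setT
    (fun x : R => (`|profile p (x + eps)| `^ p * normal_pdf 0 1 x)%:E).
  apply/measurable_EFinP; apply: measurable_funM => //.
  exact: measurable_normal_pdf.
have g0 (x : R) : (0 <= (`|profile p (x + eps)| `^ p * normal_pdf 0 1 x)%:E)%E.
  by rewrite lee_fin mulr_ge0 ?powR_ge0 ?normal_pdf_ge0.
apply/eqP; rewrite -leye_eq.
apply: (@le_trans _ _ (\int[lebesgue_measure]_(x in `[1%R, +oo[)
    (c `^ p * normal_peak 1)%:E)%E).
  rewrite integral_cst//= lebesgue_measure_itv/= ltry.
  by rewrite (_ : (+oo - 1%:E)%E = +oo%E)// gt0_muley// lte_fin.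
apply: (@le_trans _ _ (\int[lebesgue_measure]_(x in `[1%R, +oo[)
    (`|profile p (x + eps)| `^ p * normal_pdf 0 1 x)%:E)%E); last first.
  exact: ge0_subset_integral.
apply: ge0_le_integral => //.
- by move=> x _; rewrite lee_fin ltW.
- exact: measurable_funTS.
move=> x /=; rewrite in_itv/= andbT => x1; rewrite lee_fin.
have lb := profile_shift_lb e01 x1.
have l0 : 0 <= c * expR (gauss_exponent p x) by rewrite mulr_ge0 ?expR_ge0 ?ltW.
have f0 := le_trans l0 lb.
have : (c * expR (gauss_exponent p x)) `^ p <= `|profile p (x + eps)| `^ p.
  by rewrite ger0_norm// ge0_ler_powR ?nnegrE// ltW.
rewrite powRM ?expR_ge0 ?(ltW c0)// -expRM gauss_exponentM// => h.
apply: le_trans (ler_wpM2r (normal_pdf_ge0 0 1 x) h).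
by rewrite normal_pdf01 mulrACA -mulrA -expRD subrr expR0 mulr1.
Qed.

End divergence.

(** * The Cameron-Martin direction h(t) = t *)

Section cameron_martin.
Context {R : realType}.
Local Notation mu := (@lebesgue_measure R).

Lemma cm_density_id : cm_density (fun t : time R => val t) (cst 1).
Proof.
split; first exact: measurable_cst.
- under eq_integral do rewrite expr1n.
  rewrite integral_cst//=; last exact: measurable_itv.
  by rewrite lebesgue_measure_itv/= lte_fin ltr01 sube0 mule1 ltry.
- move=> t; rewrite Rintegral_cst//= lebesgue_measure_itv/= lte_fin.
  have := svalP t; rewrite inE /unit_itv /= in_itv/= => /andP[t0 _].
  rewrite mul1r; case: ltP => [_|t0']; first by rewrite /= subr0.
  by apply/eqP; rewrite eq_le t0'.
Qed.

Lemma cm_id_subproof : (fun t : time R => val t) \in cm_fun.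
Proof. by rewrite inE; exists (cst 1); exact: cm_density_id. Qed.

Definition cm_id : CM R := MkCM cm_id_subproof.

Lemma cm_norm_id : `|cm_id| = 1.
Proof.
have d : cm_density cm_id (cst 1) := cm_density_id.
rewrite [LHS](_ : _ = Num.sqrt (cm_inner cm_id cm_id))//.
rewrite (cm_innerE d d) (_ : (fun x => _) = cst 1); last first.
  by apply/funext => x; rewrite /= mulr1.
rewrite Rintegral_cst/=; last exact: measurable_itv.
by rewrite lebesgue_measure_itv/= lte_fin ltr01 mul1r/= subr0 sqrtr1.
Qed.

(** By the Cauchy-Schwarz inequality the map is Lipschitz. *)
Lemma cm_inner_continuous (h : CM R) : continuous (cm_inner ^~ h).
Proof.
move=> x; apply/(@cvgrPdist_le _ _ _ (nbhs (x : CM R)) _) => e e0.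
(* The summand 1 avoids the case distinction on h = 0. *)
have k0 : 0 < e / (`|h| + 1) by rewrite divr_gt0// ltr_wpDl.
near=> y.
have yx : `|x - y| <= e / (`|h| + 1).
  by near: y; apply: cvgr_dist_le => //; exact: cvg_id.
have -> : cm_inner x h - cm_inner y h = cm_inner (x - y) h.
  by have := cm_innerDl (x - y) y h; rewrite subrK => ->; rewrite addrK.
apply: le_trans (cm_CauchySchwarz _ _) _.
apply: (@le_trans _ _ (e / (`|h| + 1) * `|h|)); first by rewrite ler_wpM2r ?sqrtr_ge0.
rewrite mulrAC ler_pdivrMr ?ltr_wpDl// ler_pM2l// lerDl.
exact: ler01.
Unshelve. all: by end_near. Qed.

Variable P : probability (C0 R) R.

Lemma one_step_mono : {homo (fun i => if i == 0%N then time0 else time1 : time R) :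
  i j / (i <= j)%N >-> val i <= val j}.
Proof. by case=> [|i] [|j] //= _; exact: ler01. Qed.

(** The density of h is a.e. the constant 1, which is itself a step function:
    the constant sequence with a single step ]0, 1] has both errors equal to
    zero. *)
Lemma wiener_integral_id : wiener_integral P cm_id (fun w => w time1).
Proof.
split; first exact: measurable_C0_eval.
exists (fun _ => SimpleIntegrand 1 (fun=> 1) one_step_mono); split.
  rewrite (_ : (fun _ => _) = cst 0%E); first exact: cvg_cst.
  apply/funext => k /=.
  have [mh _ _] := cm_derivP cm_id.
  set s := si_fun _.
  have sE : s = \1_(`]0, 1]%classic).
    by apply/funext => x; rewrite /s /si_fun big_ord1 mul1r.
  rewrite (ae_eq_integral (cst 0%E)) ?integral0//.
  - exact: measurable_itv.
  - apply/measurable_EFinP; apply: measurable_funX; apply: measurable_funB => //.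
    by rewrite sE; exact: measurable_indic.
  - have h1 := cm_density_uniq (cm_derivP cm_id) cm_density_id.
    have h2 : {ae mu, forall x : R, x != 0}.
      exists [set 0]; split; [exact: measurable_set1|exact: lebesgue_measure_set1|].
      by move=> x /= /negP; rewrite negbK => /eqP.
    apply: (filterS2 (ae_filter_ringOfSetsType mu) _ h1 h2) => x /= x1 x0 Ix.
    rewrite x1// sE indicE mem_set ?subrr ?expr0n//=.
    move: Ix; rewrite /unit_itv /= !in_itv/= => /andP[x0' ->].
    by rewrite lt_neqAle eq_sym x0 x0'.
rewrite (_ : (fun _ => _) = cst 0%E); first exact: cvg_cst.
apply/funext => k /=; rewrite unlock.
rewrite (eq_integral (cst 0%E)) ?integral0// => w _.
by rewrite /si_integral /= big_ord1 /= C0_time0 mul1r subr0 subrr expr0n.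
Qed.

(** Cylindrical random variables are defined by multivariate polynomials; this
    transports a univariate polynomial together with its derivative. *)
Lemma mpoly_of_poly (q : {poly R}) : exists f : mpoly.mpoly 1 R, forall x : 'I_1 -> R,
  mpoly.meval x f = q.[x ord0] /\ mpoly.meval x (mpoly.mderiv ord0 f) = q^`().[x ord0].
Proof.
elim/poly_ind: q => [|q c [f fP]].
  exists 0 => x; rewrite mpoly.mderiv0 mpoly.meval0.
  by rewrite derivC !horner0.
exists (f * mpoly.mpolyX R (mpoly.mnm1 ord0) + mpoly.mpolyC 1 c) => x.
have [fx dfx] := fP x.
rewrite mpoly.mderivD mpoly.mderivM mpoly.mderivC !mpoly.mevalD !mpoly.mevalM.
rewrite mpoly.mevalXU mpoly.mevalC fx dfx.
rewrite mpoly.mderivX mpoly.mnm1E eqxx scale1r derivD derivM derivX derivC addr0 mulr1.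
rewrite hornerD hornerM hornerX hornerC hornerD hornerM hornerX.
rewrite mpoly.mevalX big_ord1 mpoly.mnmBE subnn expr0 mulr1 mpoly.meval0 addr0.
by split.
Qed.

End cameron_martin.

(** * The counterexample *)

Section main.
Context {R : realType} (P : probability (C0 R) R) (p : R).
Hypotheses (hP : wiener_measure P) (p1 : 1 < p).
Let p0 : 0 < p. Proof. exact: lt_trans p1. Qed.

Definition counterexample (w : C0 R) : R := profile p (w time1).

Lemma measurable_fun_W1 (f : R -> R) : measurable_fun setT f ->
  measurable_fun [set: completed_C0 P] (fun w : C0 R => f (w time1)).
Proof. by move=> mf; apply: (measurableT_comp mf); exact: measurable_C0_eval. Qed.

Lemma Lp_real_counterexample : Lp_real P p counterexample.
Proof.
split; first exact: measurable_fun_W1 (measurable_profile p1).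
apply: le_lt_trans (expectation_envelope hP p1).
apply: ge0_le_expectation.
- by apply: measurable_powR_norm; exact: measurable_fun_W1 (measurable_profile p1).
- by apply: measurable_powR_norm; apply: measurable_fun_W1; exact: measurable_envelope.
- move=> w; rewrite powR_ge0/= (ge0_ler_powR (ltW p0)) ?nnegrE//.
  exact: le_trans (profile_le_envelope p1 _) (ler_norm _).
Qed.

Lemma smooth_rv_poly (q : {poly R}) :
  smooth_rv P (fun w => q.[w time1]) (fun w => q^`().[w time1] *: cm_id).
Proof.
have [f fP] := mpoly_of_poly q.
exists 1%N, (fun=> cm_id), (fun _ w => w time1), f; split.
- by [].
- by move=> _; exact: wiener_integral_id.
- by move=> w; rewrite (fP (fun=> w time1)).1.
- by move=> w; rewrite big_ord1 (fP (fun=> w time1)).2.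
Qed.

(** The partial sums of the profile, evaluated at W_1, and their derivatives are
    both dominated by the envelope. The derivatives are all multiples of one
    unit vector of H, so their Cauchy property is that of real random
    variables. *)
Lemma D1p_counterexample : D1p P p counterexample.
Proof.
split; first exact: Lp_real_counterexample.
exists (fun n w => (profile_poly p n.+1).[w time1]),
  (fun n w => (profile_poly p n.+1)^`().[w time1] *: cm_id).
have mB : measurable_fun [set: completed_C0 P] (fun w : C0 R => envelope p (w time1)).
  by apply: measurable_fun_W1; exact: measurable_envelope.
have fB := expectation_envelope hP p1.
split.
- by move=> n; exact: smooth_rv_poly.
- apply: (dominated_convergence_Lp _ _ mB _ _ fB); first exact: ltW.
  + by move=> n; apply: measurable_fun_W1; exact: measurable_poly.
  + move=> w; have := @is_cvg_profile_poly _ _ p1 (w time1).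
    by rewrite -(cvg_shiftS (fun n => (profile_poly p n).[w time1])).
  + by move=> n w; exact: profile_poly_le_envelope.
pose u n (w : C0 R) := (profile_poly p n.+1)^`().[w time1].
pose v (w : C0 R) := limn (u ^~ w).
have mu n : measurable_fun [set: completed_C0 P] (u n).
  by apply: measurable_fun_W1; exact: measurable_poly.
have uv w : u n w @[n --> \oo] --> v w by exact: is_cvg_deriv_profile_poly.
have mv : measurable_fun [set: completed_C0 P] v.
  by apply: (measurable_fun_cvg mu) => w _; exact: uv.
have uvp := dominated_convergence_Lp (ltW p1) mu mB uv
  (fun n w => deriv_profile_poly_le_envelope p1 n (w time1)) fB.
move=> e e0; have [N uN] := Lp_Cauchy (ltW p0) mu mv uvp e0.
exists N => m n Nm Nn; apply: le_lt_trans (uN m n Nm Nn).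
rewrite le_eqVlt; apply/orP; left; apply/eqP; congr expectation.
by apply/funext => w; rewrite -scalerBl normrZ cm_norm_id mulr1.
Qed.

(** Cauchy-Schwarz: |<DZ, h>| <= |h| |DZ|. *)
Lemma Lp_cm_inner (DZ : C0 R -> CM R) (h : CM R) : Lp_CM P p DZ ->
  Lp_real P p (fun w => cm_inner (DZ w) h).
Proof.
move=> [mDZ fDZ].
have mI : measurable_fun [set: CM R] (fun x : CM R => cm_inner x h).
  exact: (@continuous_borel_measurable R (CM R) _ (@cm_inner_continuous R h)).
have mN : measurable_fun [set: CM R] (fun x : CM R => `|x|).
  exact: (@continuous_borel_measurable R (CM R) _ (@norm_continuous R (CM R))).
have mNDZ : measurable_fun [set: completed_C0 P] (fun w : C0 R => `|DZ w|).
  exact: (measurableT_comp mN).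
have mIDZ : measurable_fun [set: completed_C0 P] (fun w : C0 R => cm_inner (DZ w) h).
  exact: (measurableT_comp mI).
split => //.
have mhN : measurable_fun [set: completed_C0 P] (fun w : C0 R => `|h| * `|DZ w|).
  exact: (measurable_funM (measurable_cst `|h|) mNDZ).
have := expectation_powR_normZ (completion P) p `|h| mNDZ.
under [X in (_ * expectation _ X)%E]eq_fun do rewrite normr_id.
move=> hDZ; apply: (@le_lt_trans _ _ ((`| `|h| | `^ p)%:E *
    expectation (completion P) (fun w => `|DZ w| `^ p)%R)%E); last first.
  by rewrite lte_mul_pinfty ?lee_fin ?powR_ge0.
rewrite -hDZ; apply: ge0_le_expectation.
- exact: (measurable_powR_norm p mIDZ).
- exact: (measurable_powR_norm p mhN).
- move=> w; rewrite powR_ge0/= (ge0_ler_powR (ltW p0)) ?nnegrE//.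
  by rewrite mulrC [leRHS]ger0_norm ?mulr_ge0//; exact: cm_CauchySchwarz.
Qed.

Lemma Lp_realD (X Y : C0 R -> R) : Lp_real P p X -> Lp_real P p Y ->
  Lp_real P p (fun w => X w + Y w).
Proof.
move=> [mX fX] [mY fY]; split; first exact: measurable_funD.
apply: le_lt_trans (expectation_powR_normD _ (ltW p0) mX mY) _.
by rewrite lte_mul_pinfty ?lee_fin ?powR_ge0// lte_add_pinfty.
Qed.

Lemma Lp_realZ (a : R) (X : C0 R -> R) : Lp_real P p X ->
  Lp_real P p (fun w => a * X w).
Proof.
move=> [mX fX]; split.
  exact: (measurable_funM (measurable_cst a) mX).
rewrite (expectation_powR_normZ (completion P) p a mX).
by rewrite lte_mul_pinfty ?lee_fin ?powR_ge0.
Qed.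

(** The expectation in the definition tends to 0, so it is finite for some
    eps in ]0, 1]. Solving for Z o tau_(eps h) in the difference quotient
    writes it as a combination of elements of L^p, whereas its p-th moment is
    infinite. *)
Lemma not_SSGD_counterexample : ~ SSGD P p counterexample.
Proof.
move=> [DZ [LDZ /(_ cm_id) cvgDZ]].
have [eps [e01 feps]] : exists eps : R, 0 < eps <= 1 /\
    (expectation (completion P) (fun w => `|(counterexample (tau (eps *: cm_id) w) -
       counterexample w) / eps - cm_inner (DZ w) cm_id| `^ p)%R < +oo)%E.
  have /cvg_dnbhs_at_right/fine_cvgP[fin _] := cvgDZ.
  have : \forall eps \near (0 : R)^'+, 0 < eps <= 1 /\
    expectation (completion P) (fun w => `|(counterexample (tau (eps *: cm_id) w) -
       counterexample w) / eps - cm_inner (DZ w) cm_id| `^ p)%R \is a fin_num.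
    near=> eps; split; last first.
      near: eps; exact: fin.
    by apply/andP; split; near: eps; [exact: nbhs_right_gt|exact: nbhs_right_le].
  move=> /filter_ex[eps [e01 fe]]; exists eps; split => //.
  by rewrite ltey_eq fe.
have e0 : eps != 0 by case/andP: e01 => e0 _; rewrite gt_eqF.
have tauE w : counterexample (tau (eps *: cm_id) w) = profile p (w time1 + eps).
  congr (profile p (_ + _)); exact: mulr1.
have LQ : Lp_real P p (fun w => (counterexample (tau (eps *: cm_id) w) -
       counterexample w) / eps - cm_inner (DZ w) cm_id).
  split; last exact: feps.
  apply: measurable_funB; last exact: (Lp_cm_inner cm_id LDZ).1.
  apply: measurable_funM => //; apply: measurable_funB; last exact: Lp_real_counterexample.1.
  under eq_fun do rewrite tauE.
  apply: (measurable_fun_W1 (f := fun x => profile p (x + eps))).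
  by apply: (measurableT_comp (measurable_profile p1)); exact: measurable_funD.
have [_] : Lp_real P p (fun w => profile p (w time1 + eps)).
  have := Lp_realD Lp_real_counterexample
    (Lp_realZ eps (Lp_realD LQ (Lp_cm_inner cm_id LDZ))).
  congr (Lp_real P p _); apply/funext => w.
  by rewrite subrK mulrC divfK// addrC subrK tauE.
by rewrite expectation_profile_shift// ltxx.
Unshelve. all: by end_near. Qed.

End main.

Theorem theorem3p1 (R : realType) (P : probability (C0 R) R)
    (hP : wiener_measure P) (p : R) (hp : 1 < p) :
  exists Z : C0 R -> R, D1p P p Z /\ ~ SSGD P p Z.
Proof.
exists (counterexample p); split; first exact: D1p_counterexample.
exact: not_SSGD_counterexample.
Qed.
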